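(* Let $I\subseteq\mathbb{R}$ be an interval, let $f:I\to\mathbb{R}$ be differentiable on $I^\circ$, let $a,b\in I$ with $a<b$, let $0\le\lambda\le\frac12\le\mu\le1$, and suppose $f'\in L[a,b]$. If $q>1$, $|f'(x)|^q$ is convex on $[a,b]$, and $q\ge p>0$, then $$\left|(1-\mu)f(a)+\lambda f(b)+(\mu-\lambda)f\left(\frac{a+b}2\right)-\frac1{b-a}\int_a^bf(x)\,dx\right|$$ $$\le(b-a)\left(\frac{q-1}{2q-p-1}\right)^{1-1/q}\left[\frac1{(p+1)(p+2)}\right]^{1/q}\Bigg\{\left[\left(\frac12-\lambda\right)^{(2q-p-1)/(q-1)}+\lambda^{(2q-p-1)/(q-1)}\right]^{1-1/q}$$ $$\times\left(\left[\frac12(p+1+2\lambda)\left(\frac12-\lambda\right)^{p+1}+\lambda^{p+2}\right]|f'(a)|^q+\left[\frac12(p+3-2\lambda)\left(\frac12-\lambda\right)^{p+1}+(p+2-\lambda)\lambda^{p+1}\right]|f'(b)|^q\right)^{1/q}$$ $$+\left[\left(\mu-\frac12\right)^{(2q-p-1)/(q-1)}+(1-\mu)^{(2q-p-1)/(q-1)}\right]^{1-1/q}$$ $$\times\left(\left[\frac12(p+1+2\mu)\left(\mu-\frac12\right)^{p+1}+(p+1+\mu)(1-\mu)^{p+1}\right]|f'(a)|^q+\left[\frac12(p+3-2\mu)\left(\mu-\frac12\right)^{p+1}+(1-\mu)^{p+2}\right]|f'(b)|^q\right)^{1/q}\Bigg\}.$$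
   Context: $I^\circ$ denotes the interior of $I$, and $L[a,b]$ denotes the Lebesgue integrable functions on $[a,b]$. The hypotheses on $f'$ over $[a,b]$ presuppose that $f'$ exists at every point of $[a,b]$ (as a one-sided derivative at $a$ or $b$ if that point is an endpoint of $I$). *)

(* Defs.v *)
From HB Require Import structures.
From mathcomp Require Import all_boot all_order all_algebra.
From mathcomp Require Import all_classical all_reals all_analysis.
Set Implicit Arguments.
Unset Strict Implicit.
Unset Printing Implicit Defensive.
Import Order.TTheory GRing.Theory Num.Theory.
Import numFieldNormedType.Exports.
Local Open Scope classical_set_scope.
Local Open Scope ring_scope.

(* Derivative of [f] relative to [I]: [derivable f x 1] and [f^`()], with the
   increments [h] restricted to [I (h + x)].  It is the ordinary derivative at
   interior points of [I], the one-sided one at an endpoint belonging to [I],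
   and the values of [f] outside [I] are irrelevant. *)
Definition derivable_in (R : realType) (I : set R) (f : R -> R) (x : R) : Prop :=
  cvg ((fun h => h^-1 * (f (h + x) - f x))
         @ within [set h | I (h + x)] (0 : R)^').

Definition derive_in (R : realType) (I : set R) (f : R -> R) (x : R) : R :=
  lim ((fun h => h^-1 * (f (h + x) - f x))
         @ within [set h | I (h + x)] (0 : R)^').

(* Main.v *)
Require Import Defs.
From HB Require Import structures.
From mathcomp Require Import all_boot all_order all_algebra.
From mathcomp Require Import all_classical all_reals all_analysis.
From mathcomp Require Import ring lra.
Set Implicit Arguments.
Unset Strict Implicit.
Unset Printing Implicit Defensive.
Import Order.TTheory GRing.Theory Num.Theory.
Import numFieldNormedType.Exports.
Local Open Scope classical_set_scope.
Local Open Scope ring_scope.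

(** Let [L = b - a], [m = (a + b) / 2], and let [c] be one of the two nodes
    [mu a + (1 - mu) b] in [[a, m]] and [lambda a + (1 - lambda) b] in [[m, b]].
    On the half [[u, v]] that contains [c], the function
    [H y = (y - c) f y - \int_u^y f] satisfies
    [H v - H u = (v - c) f v + (c - u) f u - \int_u^v f] and
    [H' y = (y - c) f' y].  The two increments add up to [L] times the quantity
    to be estimated, so each of them is bounded separately.

    The classical argument writes [H v - H u] as the integral of [H'] and then
    splits [|s| = |s|^((q - p) / q) |s|^(p / q)] in Hölder's inequality, with
    [s = (y - c) / L].  Here the integrals of [H'] are avoided altogether.  For
    every [x > 0], Young's inequality bounds [|s| |f'|] pointwise by a
    combination of [|s|^k], [k = (q - p) / (q - 1)], and [|s|^p |f'|^q]
    ([young_powR]); convexity replaces [|f'|^q] by an affine function of [s];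
    and the resulting majorant has an explicit primitive.  The mean value
    theorem then compares the increment of [H] with that of the primitive
    ([normr_sub_le_of_derive], [normr_kernel_le]), and optimising over [x]
    gives back the product of powers that Hölder's inequality would give
    ([le_powR_prod], [quadrature_le]). *)

(** * Real powers *)

Lemma powRD_gt0 (R : realType) (x r s : R) : 0 < x ->
  x `^ (r + s) = x `^ r * x `^ s.
Proof. by move=> x_gt0; rewrite powRD// (gt_eqF x_gt0) implybT. Qed.

Lemma mulr_powRB1_gt0 (R : realType) (k u : R) : 0 < u ->
  u * u `^ (k - 1) = u `^ k.
Proof.
by move=> u_gt0; rewrite -{1}(powRr1 (ltW u_gt0)) -powRD_gt0// subrKC.
Qed.

Lemma mulr_powRD1 (R : realType) (k x : R) : 0 <= k -> 0 <= x ->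
  x * x `^ k = x `^ (k + 1).
Proof.
by move=> k_ge0 x_ge0; rewrite -[RHS]mulr_powRB1 ?addrK // ltr_wpDl.
Qed.

(** The weighted form of Young's inequality: the right-hand side is the weighted
    arithmetic mean, with weights [1 - 1 / q] and [1 / q], of two terms whose
    weighted geometric mean is [s * g]; the powers of [x] cancel in it. *)
Lemma young_powR (R : realType) (p q x s g : R) : 1 < q -> 0 < x ->
  0 <= s -> 0 <= g -> 0 < p -> p <= q ->
  s * g <= (1 - 1 / q) * x * s `^ ((q - p) / (q - 1))
           + 1 / q * x `^ (1 - q) * (s `^ p * g `^ q).
Proof.
move=> q_gt1 x_gt0 s_ge0 g_ge0 p_gt0 pq.
have q_gt0 : 0 < q by lra.
have q_neq0 : q != 0 by lra.
have q1_neq0 : q - 1 != 0 by lra.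
move: s_ge0; rewrite le_eqVlt => /predU1P[<-|s_gt0].
  rewrite mul0r (@powR0 _ p) ?gt_eqF// mul0r mulr0 addr0.
  rewrite !mulr_ge0 ?powR_ge0 ?ltW// subr_gt0 ltr_pdivrMr//; lra.
have q1_gt0 : 0 < q / (q - 1) by rewrite divr_gt0//; lra.
(* The factors raised to the conjugate exponents [q / (q - 1)] and [q] are the
   two terms of the mean; their powers of [s] have exponents of sum [1]. *)
have := @conjugate_powR R (x `^ (1 - 1 / q) * s `^ ((q - p) / q))
   (x `^ ((1 - q) / q) * s `^ (p / q) * g) (q / (q - 1)) q.
rewrite !mulr_ge0 ?powR_ge0// => /(_ isT isT q1_gt0 q_gt0).
have -> : (q / (q - 1))^-1 + q^-1 = 1 by field; rewrite ?q_neq0 ?q1_neq0.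
move=> /(_ erefl).
rewrite !powRM ?mulr_ge0 ?powR_ge0// -!powRrM.
have -> : (1 - 1 / q) * (q / (q - 1)) = 1 by field; rewrite ?q_neq0 ?q1_neq0.
have -> : (q - p) / q * (q / (q - 1)) = (q - p) / (q - 1).
  by field; rewrite ?q_neq0 ?q1_neq0.
have -> : (1 - q) / q * q = 1 - q by field.
have -> : p / q * q = p by field.
rewrite powRr1 ?(ltW x_gt0)//.
have -> : x `^ (1 - 1 / q) * s `^ ((q - p) / q) *
    (x `^ ((1 - q) / q) * s `^ (p / q) * g) =
  (x `^ (1 - 1 / q) * x `^ ((1 - q) / q)) *
  (s `^ ((q - p) / q) * s `^ (p / q)) * g by ring.
rewrite -!powRD_gt0//.
have -> : 1 - 1 / q + (1 - q) / q = 0 by field.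
have -> : (q - p) / q + p / q = 1 by field.
rewrite powRr0 mul1r powRr1 ?(ltW s_gt0)// => /le_trans; apply.
rewrite le_eqVlt; apply/orP; left; apply/eqP; field.
by rewrite q_neq0 q1_neq0.
Qed.

(** Optimising a family of Young bounds over its parameter: the two summands
    balance at [x = (M2 / M1) `^ (1 / q)].  If [M2 = 0] that value degenerates,
    but then [x = X / M1] rules out a positive [X]. *)
Lemma le_powR_prod (R : realType) (q X M1 M2 : R) :
  1 < q -> 0 < M1 -> 0 <= M2 ->
  (forall x, 0 < x ->
     X <= (1 - 1 / q) * x * M1 + 1 / q * x `^ (1 - q) * M2) ->
  X <= M1 `^ (1 - 1 / q) * M2 `^ (1 / q).
Proof.
move=> q_gt1 M1_gt0 + X_le.
have q_gt0 : 0 < q by lra.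
have q_neq0 : q != 0 by lra.
rewrite le_eqVlt => /predU1P[M2_eq0|M2_gt0].
  rewrite -M2_eq0 powR0 ?mulr0; last by rewrite gt_eqF// divr_gt0.
  rewrite leNgt; apply/negP => X_gt0.
  have := X_le (X / M1) (divr_gt0 X_gt0 M1_gt0).
  rewrite -M2_eq0 mulr0 addr0 -mulrA divfK ?gt_eqF//.
  have : 0 < 1 / q * X by rewrite mulr_gt0// divr_gt0.
  by lra.
have xM a : (M2 / M1) `^ a = M2 `^ a * M1 `^ (- a).
  rewrite powRM ?invr_ge0 ?ltW// -(powR_inv1 (ltW M1_gt0)) -powRrM mulN1r//.
have M1r : M1 `^ (1 - 1/q) = M1 `^ (- (1 / q)) * M1.
  rewrite -{3}(powRr1 (ltW M1_gt0)) -powRD_gt0//; congr (_ `^ _); ring.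
have M2r : M2 `^ (1 / q) = M2 `^ (1 / q * (1 - q)) * M2.
  rewrite -{3}(powRr1 (ltW M2_gt0)) -powRD_gt0//.
  by congr (_ `^ _); field.
have M1r' : M1 `^ (1 - 1/q) = M1 `^ (- (1 / q * (1 - q))).
  by congr (_ `^ _); field.
have /X_le/le_trans : 0 < (M2 / M1) `^ (1 / q) by rewrite powR_gt0// divr_gt0.
apply; rewrite -powRrM !xM -M1r'.
rewrite le_eqVlt; apply/orP; left; apply/eqP.
have -> : (1 - 1 / q) * (M2 `^ (1 / q) * M1 `^ (- (1 / q))) * M1 =
  (1 - 1 / q) * (M1 `^ (1 - 1 / q) * M2 `^ (1 / q)) by rewrite M1r; ring.
have -> : 1 / q * (M2 `^ (1 / q * (1 - q)) * M1 `^ (1 - 1 / q)) * M2 =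
  1 / q * (M1 `^ (1 - 1 / q) * M2 `^ (1 / q)) by rewrite M2r; ring.
by rewrite M1r; ring.
Qed.

(** Distributes the powers over the quotients by [e] and [n], to bring out the
    factor that the two halves of the estimate share. *)
Lemma powR_bound_split (R : realType) (S N e n q : R) :
  0 <= S -> 0 <= N -> 0 < e -> 0 < n ->
  (S / e) `^ (1 - 1 / q) * (N / n) `^ (1 / q) =
  e^-1 `^ (1 - 1 / q) * (1 / n) `^ (1 / q)
  * (S `^ (1 - 1 / q) * N `^ (1 / q)).
Proof.
move=> S_ge0 N_ge0 e_gt0 n_gt0.
by rewrite (div1r n) !powRM ?invr_ge0 ?(ltW e_gt0) ?(ltW n_gt0)//; ring.
Qed.

(** * The primitive of the majorant *)

(** The factor [s] makes this signed power differentiable at [0] also, so that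
    no interval has to be cut at its node. *)
Lemma is_derive_mul_normr_powR (R : realType) (k x : R) : 0 <= k ->
  is_derive x 1 (fun s : R => s * `|s| `^ k) ((k + 1) * `|x| `^ k).
Proof.
move=> k_ge0; have [x_lt0|x_gt0|->] := ltgtP x 0.
- apply: (@near_eq_is_derive _ _ _ (fun s : R => s * (- s) `^ k)).
    by near=> s; rewrite ltr0_norm//; near: s; exact: lt_nbhsl.
  have nx_gt0 : 0 < - x by rewrite oppr_gt0.
  have dk := is_derive1_powR k nx_gt0.
  have dc := is_derive1_comp dk (is_deriveNid x 1).
  apply: is_derive_eq; rewrite ltr0_norm// /GRing.scale/= mulr1.
  by rewrite -(mulr_powRB1_gt0 k nx_gt0); ring.
- apply: (@near_eq_is_derive _ _ _ (fun s : R => s * s `^ k)).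
    by near=> s; rewrite gtr0_norm//; near: s; exact: lt_nbhsr.
  have dk := is_derive1_powR k x_gt0.
  apply: is_derive_eq; rewrite gtr0_norm// /GRing.scale/= mulr1.
  by rewrite -(mulr_powRB1_gt0 k x_gt0); ring.
- have cvg_k : `|h| `^ k @[h --> (0:R)^'] --> (k + 1) * `|0:R| `^ k.
    move: k_ge0; rewrite normr0 le_eqVlt => /predU1P[<-|k_gt0].
      rewrite powRr0 add0r mulr1.
      by under eq_fun do rewrite powRr0; exact: cvg_cst.
    rewrite powR0 ?gt_eqF// mulr0.
    apply: (cvg_comp _ _ _ (powR_cvg0 k_gt0)) => A [e e_gt0 eA].
    exists e => // h; rewrite /ball_/= sub0r normrN => he h_neq0.
    by apply: eA; rewrite /ball_/= ?sub0r ?normrN ?normr_id// normr_gt0.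
  have cvg_q : h^-1 *: (((fun s : R => s * `|s| `^ k) \o shift 0) (h *: 1)
      - 0 * `|0:R| `^ k) @[h --> (0:R)^'] --> (k + 1) * `|0:R| `^ k.
    apply: cvg_trans cvg_k; apply: near_eq_cvg; near=> h.
    rewrite /= /GRing.scale/= mulr1 addr0 mul0r subr0 mulKf//.
    by near: h; exact: nbhs_dnbhs_neq.
  split; first by apply/cvg_ex; exists ((k + 1) * `|0:R| `^ k).
  exact: cvg_lim.
Unshelve. all: by end_near. Qed.

(** The primitive of [`|s| `^ k * (alpha + beta * s)]. *)
Definition primitive_linear_weight (R : realType) (k alpha beta s : R) : R :=
  alpha / (k + 1) * (s * `|s| `^ k) + beta / (k + 2) * (s * (s * `|s| `^ k)).

Lemma is_derive_primitive_linear_weight (R : realType) (k alpha beta x : R) :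
  0 <= k ->
  is_derive x 1
    (primitive_linear_weight k alpha beta)
    (`|x| `^ k * (alpha + beta * x)).
Proof.
move=> k_ge0; have D := is_derive_mul_normr_powR x k_ge0.
apply: is_derive_eq; rewrite /GRing.scale/=; field.
by rewrite !gt_eqF//; lra.
Qed.

Lemma primitive_linear_weightB (R : realType) (k alpha beta l r : R) :
  0 <= k -> 0 <= l -> 0 <= r ->
  primitive_linear_weight k alpha beta r
    - primitive_linear_weight k alpha beta (- l) =
  alpha / (k + 1) * (r `^ (k + 1) + l `^ (k + 1))
  + beta / (k + 2) * (r `^ (k + 2) - l `^ (k + 2)).
Proof.
move=> k_ge0 l_ge0 r_ge0; rewrite /primitive_linear_weight normrN !ger0_norm//.
have k1_ge0 : 0 <= k + 1 by rewrite addr_ge0.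
have -> : k + 2 = (k + 1) + 1 by ring.
by rewrite -!mulr_powRD1//; ring.
Qed.

Lemma primitive_linear_weight_le (R : realType) (k alpha beta u v : R) :
  0 <= k -> u <= v -> {in `]u, v[, forall s, 0 <= alpha + beta * s} ->
  primitive_linear_weight k alpha beta u
    <= primitive_linear_weight k alpha beta v.
Proof.
move=> k_ge0 uv ge0.
have D s := is_derive_primitive_linear_weight alpha beta s k_ge0.
apply: (@ger0_derive1_ndecr _ _ u v) => //.
- move=> s /ge0 s_ge0; rewrite derive1E; have [_ ->] := D s.
  by rewrite mulr_ge0// powR_ge0.
- apply: continuous_subspaceT => s.
  by apply/differentiable_continuous/derivable1_diffP; case: (D s).
Qed.

(** * Bounding an increment through the derivative *)

Lemma Rintegral_itvD (R : realType) (f : R -> R) (u v w : R) :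
  u <= v -> v <= w -> {within `[u, w], continuous f} ->
  \int[lebesgue_measure]_(x in `[u, w]) f x =
  \int[lebesgue_measure]_(x in `[u, v]) f x
  + \int[lebesgue_measure]_(x in `[v, w]) f x.
Proof.
move=> uv vw cf.
have intf : lebesgue_measure.-integrable `[u, w] (EFin \o f).
  by apply: continuous_compact_integrable => //; exact: segment_compact.
rewrite -(@Rintegral_itv_obnd_cbnd R v (BRight w)); last first.
  apply: integrableS intf => //; apply: subset_itvr; rewrite bnd_simp//.
by rewrite -(Rintegral_itvB intf) ?bnd_simp// [RHS]addrC subrK.
Qed.

Lemma normr_sub_le_of_derive (R : realType) (H dH K dK : R -> R) (u v : R) :
  u <= v ->
  {within `[u, v], continuous H} -> {within `[u, v], continuous K} ->
  (forall x, x \in `]u, v[ -> is_derive x 1 H (dH x)) ->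
  (forall x, x \in `]u, v[ -> is_derive x 1 K (dK x)) ->
  (forall x, x \in `]u, v[ -> `|dH x| <= dK x) ->
  `|H v - H u| <= K v - K u.
Proof.
move=> uv cH cK dHE dKE dHK.
wlog: H dH cH dHE dHK / 0 <= H v - H u => [hwlog|H_ge0].
  have [/hwlog|/ltW H_le0] := leP 0 (H v - H u); first exact.
  have -> : `|H v - H u| = `|(\- H) v - (\- H) u|.
    by rewrite distrC /= opprK [in RHS]addrC.
  apply: (hwlog (\- H) (\- dH)).
  - by move=> x; exact/continuousN/cH.
  - by move=> x /dHE ?; apply: is_derive_eq.
  - by move=> x /dHK; rewrite /= normrN.
  - by rewrite /= -opprD oppr_ge0.
rewrite ger0_norm//.
have : (K - H) u <= (K - H) v.
  have D x : x \in `]u, v[ -> is_derive x 1 (K - H) (dK x - dH x).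
    by move=> xuv; apply: is_deriveB; [exact: dKE|exact: dHE].
  apply: (@ger0_derive1_ndecr _ _ u v) => //.
  - by move=> x /D [].
  - move=> x xuv; rewrite derive1E; have [_ ->] := D _ xuv.
    by rewrite subr_ge0 (le_trans (ler_norm _))// dHK.
  - by move=> x; exact: (continuousB (cK x) (cH x)).
by rewrite /= !fctE; lra.
Qed.

(** The product rule produces [f x] once, and the fundamental theorem of
    calculus for the continuous [f] removes it: no derivative of [f] is
    integrated. *)
Lemma is_derive_kernel (R : realType) (f : R -> R) (c u v x d : R) :
  {within `[u, v], continuous f} -> x \in `]u, v[ -> is_derive x 1 f d ->
  is_derive x 1
    (fun y => (y - c) * f y - \int[lebesgue_measure]_(t in `[u, y]) f t)
    ((x - c) * d).
Proof.
move=> cf; rewrite in_itv/= => /andP[ux xv] df.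
have intf : lebesgue_measure.-integrable `[u, v] (EFin \o f).
  by apply: continuous_compact_integrable => //; exact: segment_compact.
have cfx : {for x, continuous f}.
  by apply/differentiable_continuous/derivable1_diffP; case: df.
have [dF F'] := continuous_FTC1_closed xv intf ux cfx.
have DF : is_derive x 1
    (fun y => \int[lebesgue_measure]_(t in `[u, y]) f t) (f x).
  by split; [exact: dF|rewrite -derive1E].
apply: is_derive_eq; rewrite /GRing.scale/=; ring.
Qed.

Lemma continuous_kernel (R : realType) (f : R -> R) (c u v : R) : u <= v ->
  {within `[u, v], continuous f} ->
  {within `[u, v], continuous
    (fun y => (y - c) * f y - \int[lebesgue_measure]_(t in `[u, y]) f t)}.
Proof.
move=> uv cf.
have intf : lebesgue_measure.-integrable `[u, v] (EFin \o f).
  by apply: continuous_compact_integrable => //; exact: segment_compact.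
have cF := parameterized_integral_continuous uv intf.
have cid : {within `[u, v], continuous (fun y : R => y - c)}.
  apply: continuous_subspaceT => y.
  by apply: continuousB; [exact: cvg_id|exact: cvg_cst].
by move=> y; exact: (continuousB (continuousM (cid y) (cf y)) (cF y)).
Qed.

(** The case of one value of the Young parameter [x].  Points are written
    [c + L * s], so that the bound is [L ^+ 2] times an expression in the
    dimensionless [l] and [r]. *)
Lemma normr_kernel_le (R : realType) (f df : R -> R)
    (c L l r alpha beta p q x : R) :
  0 < L -> - l <= r -> 1 < q -> 0 < p -> p <= q -> 0 < x ->
  {within `[c - L * l, c + L * r], continuous f} ->
  {in `]- l, r[, forall s, is_derive (c + L * s) 1 f (df s)} ->
  {in `]- l, r[, forall s, `|df s| `^ q <= alpha + beta * s} ->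
  let k := (q - p) / (q - 1) in
  `| L * r * f (c + L * r) + L * l * f (c - L * l)
     - \int[lebesgue_measure]_(y in `[c - L * l, c + L * r]) f y |
  <= L ^+ 2 *
     ((1 - 1 / q) * x * (primitive_linear_weight k 1 0 r
                         - primitive_linear_weight k 1 0 (- l))
     + 1 / q * x `^ (1 - q) * (primitive_linear_weight p alpha beta r
                         - primitive_linear_weight p alpha beta (- l))).
Proof.
move=> L_gt0 lr q_gt1 p_gt0 pq x_gt0 cf Df df_le /=.
set k := (q - p) / (q - 1).
have k_ge0 : 0 <= k by apply: divr_ge0; lra.
set u := c - L * l; set v := c + L * r.
have uv : u <= v by rewrite /u /v -mulrN lerD2l ler_pM2l.
(* [K] is the primitive in the variable [y]: one factor [L] comes from
   [y - c = L * s] in the derivative of [H], the other from [dy = L * ds]. *)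
pose H (y : R) : R := (y - c) * f y - \int[lebesgue_measure]_(t in `[u, y]) f t.
pose K0 (s : R) : R := (1 - 1 / q) * x * primitive_linear_weight k 1 0 s
  + 1 / q * x `^ (1 - q) * primitive_linear_weight p alpha beta s.
pose K (y : R) : R := L ^+ 2 * K0 ((y - c) / L).
pose dK0 (s : R) : R := (1 - 1 / q) * x * (`|s| `^ k * (1 + 0 * s))
  + 1 / q * x `^ (1 - q) * (`|s| `^ p * (alpha + beta * s)).
have DK (y : R) : is_derive y 1 K (L * dK0 ((y - c) / L)).
  have D1 := is_derive_primitive_linear_weight 1 0 ((y - c) / L) k_ge0.
  have D2 :=
    is_derive_primitive_linear_weight alpha beta ((y - c) / L) (ltW p_gt0).
  have D0 : is_derive ((y - c) / L) 1 K0 (dK0 ((y - c) / L)).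
    by apply: is_derive_eq.
  have Da : is_derive y 1 (fun y => (y - c) / L) L^-1.
    by apply: is_derive_eq; rewrite /GRing.scale/=; ring.
  have Dc := @is_derive1_comp R K0 (fun z => (z - c) / L) y _ _ D0 Da.
  apply: is_derive_eq; rewrite /GRing.scale/=; field; lra.
have in_s (y : R) : y \in `]u, v[ -> (y - c) / L \in `](- l), r[.
  rewrite !in_itv/= => /andP[uy yv]; rewrite ltr_pdivlMr// ltr_pdivrMr//.
  by rewrite /u /v in uy yv; apply/andP; split; lra.
have yE (y : R) : c + L * ((y - c) / L) = y by field; lra.
have := @normr_sub_le_of_derive R H (fun y => (y - c) * df ((y - c) / L)) K
  (fun y => L * dK0 ((y - c) / L)) u v uv.
have -> : H v - H u = L * r * f v + L * l * f u
     - \int[lebesgue_measure]_(y in `[u, v]) f y.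
  rewrite /H set_itv1 Rintegral_set1 /v /u; ring.
have -> : K v - K u = L ^+ 2 *
     ((1 - 1 / q) * x * (primitive_linear_weight k 1 0 r
                         - primitive_linear_weight k 1 0 (- l))
     + 1 / q * x `^ (1 - q) * (primitive_linear_weight p alpha beta r
                         - primitive_linear_weight p alpha beta (- l))).
  have -> : K v = L ^+ 2 * K0 r by rewrite /K /v; congr (_ * K0 _); field; lra.
  have -> : K u = L ^+ 2 * K0 (- l).
    by rewrite /K /u; congr (_ * K0 _); field; lra.
  rewrite /K0; ring.
apply => //.
- exact: continuous_kernel.
- apply: continuous_subspaceT => y.
  by apply/differentiable_continuous/derivable1_diffP; case: (DK y).
- move=> y yuv; apply: is_derive_kernel => //.
  by have := Df _ (in_s _ yuv); rewrite yE.
- move=> y yuv; set s := (y - c) / L.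
  have -> : y - c = L * s by rewrite /s; field; lra.
  rewrite -mulrA normrM (gtr0_norm L_gt0) ler_pM2l// normrM.
  apply: le_trans
    (young_powR q_gt1 x_gt0 (normr_ge0 _) (normr_ge0 _) p_gt0 pq) _.
  rewrite /dK0 mul0r addr0 mulr1 lerD2l ler_wpM2l//.
    by rewrite mulr_ge0 ?powR_ge0// divr_ge0//; lra.
  by rewrite ler_wpM2l ?powR_ge0// df_le// in_s.
Qed.

(** What Hölder's inequality, followed by the affine bound, would give for the
    integral of [`|y - c| * `|f'|] over an interval with node [c]. *)
Lemma quadrature_le (R : realType) (f df : R -> R)
    (c L l r alpha beta p q : R) :
  0 < L -> 0 <= l -> 0 <= r -> 0 < l + r -> 1 < q -> 0 < p -> p <= q ->
  {within `[c - L * l, c + L * r], continuous f} ->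
  {in `]- l, r[, forall s, is_derive (c + L * s) 1 f (df s)} ->
  {in `]- l, r[, forall s, `|df s| `^ q <= alpha + beta * s} ->
  let e := (2 * q - p - 1) / (q - 1) in
  `| L * r * f (c + L * r) + L * l * f (c - L * l)
     - \int[lebesgue_measure]_(y in `[c - L * l, c + L * r]) f y |
  <= L ^+ 2 * (((r `^ e + l `^ e) / e) `^ (1 - 1 / q)
     * (alpha / (p + 1) * (r `^ (p + 1) + l `^ (p + 1))
        + beta / (p + 2) * (r `^ (p + 2) - l `^ (p + 2))) `^ (1 / q)).
Proof.
move=> L_gt0 l_ge0 r_ge0 lr_gt0 q_gt1 p_gt0 pq cf Df df_le /=.
have lr : - l <= r by lra.
have q1 : q - 1 != 0 by lra.
have k_ge0 : 0 <= (q - p) / (q - 1) by apply: divr_ge0; lra.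
have -> : (2 * q - p - 1) / (q - 1) = (q - p) / (q - 1) + 1 by field.
set k := (q - p) / (q - 1).
have M1_gt0 : 0 < (r `^ (k + 1) + l `^ (k + 1)) / (k + 1).
  apply: divr_gt0; last by rewrite ltr_wpDl.
  have [r_gt0|r_le0] := ltP 0 r; first by rewrite ltr_pwDl ?powR_gt0 ?powR_ge0.
  by rewrite ltr_wpDl ?powR_ge0 ?powR_gt0//; lra.
have M2_ge0 : 0 <= primitive_linear_weight p alpha beta r
    - primitive_linear_weight p alpha beta (- l).
  rewrite subr_ge0 primitive_linear_weight_le ?(ltW p_gt0)// => s /df_le.
  exact/le_trans/powR_ge0.
rewrite -primitive_linear_weightB ?(ltW p_gt0)//.
rewrite [leRHS]mulrC -ler_pdivrMr ?exprn_gt0//.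
apply: le_powR_prod => // x x_gt0.
rewrite ler_pdivrMr ?exprn_gt0// [leRHS]mulrC.
have -> : (r `^ (k + 1) + l `^ (k + 1)) / (k + 1) =
    primitive_linear_weight k 1 0 r - primitive_linear_weight k 1 0 (- l).
  by rewrite primitive_linear_weightB//; ring.
exact: (normr_kernel_le L_gt0 lr q_gt1 p_gt0 pq x_gt0 cf Df df_le).
Qed.

(** * Convexity and derivatives relative to an interval *)

Lemma convex_function_le (R : realType) (a b : R) (g : R -> R) :
  a < b -> convex_function `[a, b] g ->
  {in `[a, b], forall x,
    g x <= (b - x) / (b - a) * g a + (x - a) / (b - a) * g b}.
Proof.
move=> ab cg x; rewrite in_itv/= => /andP[ax xb].
have ba : 0 < b - a by lra.
have t01 : 0 <= (b - x) / (b - a) <= 1.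
  by apply/andP; split; [apply: divr_ge0; lra|rewrite ler_pdivrMr//; lra].
have ain : a \in (`[a, b]%classic : set R) by rewrite inE/= in_itv/= lexx ltW.
have bin : b \in (`[a, b]%classic : set R) by rewrite inE/= in_itv/= lexx ltW.
set t := Itv01 (proj1 (andP t01)) (proj2 (andP t01)).
have := cg t a b ain bin.
rewrite !convRE /=.
have -> : conv t (a : convex_lmodType R^o) b = x.
  transitivity ((b - x) / (b - a) * a + (1 - (b - x) / (b - a)) * b) => //.
  by field; lra.
have -> : unstable.onem ((b - x) / (b - a)) = (x - a) / (b - a).
  rewrite /unstable.onem; field; lra.
exact.
Qed.

(** The increment of [f] is the step times a convergent difference quotient. *)
Lemma derivable_in_continuous (R : realType) (I : set R) (f : R -> R) (x : R) :
  derivable_in I f x -> f y @[y --> within I (nbhs x)] --> f x.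
Proof.
move=> Df; apply/cvgrPdist_lt => e e_gt0.
have h0 : h @[h --> within [set h | I (h + x)] (0:R)^'] --> (0:R).
  by do 2 apply: cvg_within_filter.
have : h * (h^-1 * (f (h + x) - f x))
    @[h --> within [set h | I (h + x)] (0:R)^'] --> (0:R).
  by have := cvgM h0 Df; rewrite mul0r; apply.
move=> /cvgrPdist_lt => H; have [d d_gt0 dP] := H _ e_gt0.
exists d => // y xy Iy.
have [->|yx] := eqVneq y x; first by rewrite subrr normr0.
have yx0 : y - x != 0 by rewrite subr_eq0.
have := dP (y - x); rewrite /ball_/= sub0r normrN subrK mulrA divff//.
by rewrite mul1r sub0r normrN distrC (distrC (f y)); apply.
Qed.

(** At an interior point the constraint on the step holds near [0], so that both
    difference quotients have the same limit. *)
Lemma is_derive_derive_in (R : realType) (I : set R) (f : R -> R) (x : R) :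
  I° x -> derivable f x 1 -> is_derive x 1 f (derive_in I f x).
Proof.
move=> Ix Df; apply: DeriveDef => //.
have Ix0 : \forall h \near (0:R)^', I (h + x).
  apply: nbhs_dnbhs.
  have : (h + x) @[h --> (0:R)] --> 0 + x.
    by apply: cvgD; [exact: cvg_id|exact: cvg_cst].
  by rewrite add0r; apply.
have DfE : h^-1 * (f (h + x) - f x) @[h --> (0:R)^'] --> 'D_1 f x.
  apply: cvg_trans Df; apply: near_eq_cvg; near=> h.
  by rewrite /= /GRing.scale/= mulr1.
have within_dnbhs0 : within [set h | I (h + x)] (0:R)^' = (0:R)^'.
  rewrite predeqE => P; split => [|HP]; last by apply: filterS HP.
  by apply: filterS2 Ix0 => h /[swap]; apply.
by rewrite /derive_in within_dnbhs0; apply/esym/cvg_lim.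
Unshelve. all: by end_near. Qed.

Lemma itvoo_sub_interior (R : realType) (I : set R) (a b : R) :
  is_interval I -> I a -> I b -> `]a, b[ `<=` I°.
Proof.
move=> iI Ia Ib; rewrite -open_subsetE; last exact: itv_open.
move=> x; rewrite /= in_itv/= => /andP[ax xb].
by apply: (iI a b) => //; rewrite !ltW.
Qed.

(** * The inequality *)

(** Convexity gives the affine bound that [quadrature_le] asks for: the node [c]
    is at [s = 0], where the chord takes the value [tau * A + (1 - tau) * B],
    and the slope of the chord in [s] is [B - A]. *)
Lemma convex_quadrature_le (R : realType) (f df : R -> R)
    (a b l r tau p q : R) :
  a < b -> 1 < q -> 0 < p -> p <= q ->
  {within `[a, b], continuous f} ->
  {in `]a, b[, forall x : R, is_derive x 1 f (df x)} ->
  convex_function `[a, b] (fun x : R => `|df x| `^ q) ->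
  0 <= l -> 0 <= r -> 0 < l + r -> r <= tau -> tau <= 1 - l ->
  let c := b - (b - a) * tau in
  let L := b - a in
  let e := (2 * q - p - 1) / (q - 1) in
  let A := `|df a| `^ q in let B := `|df b| `^ q in
  `| L * r * f (c + L * r) + L * l * f (c - L * l)
     - \int[lebesgue_measure]_(y in `[c - L * l, c + L * r]) f y |
  <= L ^+ 2 * (((r `^ e + l `^ e) / e) `^ (1 - 1 / q)
     * ((tau * A + (1 - tau) * B) / (p + 1) * (r `^ (p + 1) + l `^ (p + 1))
        + (B - A) / (p + 2) * (r `^ (p + 2) - l `^ (p + 2))) `^ (1 / q)).
Proof.
move=> ab q_gt1 p_gt0 pq cf Df cdf l_ge0 r_ge0 lr_gt0 r_tau tau_l /=.
set c := b - (b - a) * tau; set L := b - a; set e := (2 * q - p - 1) / (q - 1).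
set A := `|df a| `^ q; set B := `|df b| `^ q.
have L_gt0 : 0 < L by rewrite subr_gt0.
have inab s : s \in `](- l), r[ -> c + L * s \in `]a, b[.
  rewrite !in_itv/= => /andP[ls sr].
  have : 0 < L * (tau - s) by apply: mulr_gt0 => //; lra.
  have : 0 < L * (1 - tau + s) by apply: mulr_gt0 => //; lra.
  by rewrite /c -/L; move: (erefl L); rewrite {1}/L => ?; lra.
apply: (@quadrature_le R f (fun s => df (c + L * s))) => //.
- apply: continuous_subspaceW cf => x /=; rewrite !in_itv/= => /andP[x1 x2].
  have : 0 <= L * (tau - r) by apply: mulr_ge0; lra.
  have : 0 <= L * (1 - tau - l) by apply: mulr_ge0; lra.
  by move: x1 x2; rewrite /c -/L; move: (erefl L); rewrite {1}/L => ?; lra.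
- by move=> s /inab; exact: Df.
- move=> s /inab/subset_itv_oo_cc/(convex_function_le ab cdf)/le_trans; apply.
  rewrite -/A -/B le_eqVlt; apply/orP; left; apply/eqP; rewrite /c -/L.
  have -> : b = a + L by rewrite /L; ring.
  field; lra.
Qed.

(** The affine bound integrated against [`|s| `^ p] on the half next to [a],
    written in the coefficients of [A] and [B]. *)
Lemma left_coefficients (R : realType) (p mu A B : R) :
  0 < p -> 1 / 2 <= mu -> mu <= 1 -> 0 <= A -> 0 <= B ->
  let N := (1 / 2 * (p + 1 + 2 * mu) * (mu - 1 / 2) `^ (p + 1)
             + (p + 1 + mu) * (1 - mu) `^ (p + 1)) * A
           + (1 / 2 * (p + 3 - 2 * mu) * (mu - 1 / 2) `^ (p + 1)
             + (1 - mu) `^ (p + 2)) * B in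
  0 <= N /\
  (mu * A + (1 - mu) * B) / (p + 1) *
    ((mu - 1 / 2) `^ (p + 1) + (1 - mu) `^ (p + 1)) +
  (B - A) / (p + 2) * ((mu - 1 / 2) `^ (p + 2) - (1 - mu) `^ (p + 2)) =
  N / ((p + 1) * (p + 2)).
Proof.
move=> p_gt0 mu_ge mu_le A_ge0 B_ge0 /=.
have c1 : 0 <= 1 / 2 * (p + 1 + 2 * mu) by lra.
have c2 : 0 <= p + 1 + mu by lra.
have c3 : 0 <= 1 / 2 * (p + 3 - 2 * mu) by lra.
split.
  have P (x y : R) : 0 <= x `^ y := powR_ge0 x y.
  exact: addr_ge0 (mulr_ge0 (addr_ge0 (mulr_ge0 c1 (P _ _))
    (mulr_ge0 c2 (P _ _))) A_ge0)
    (mulr_ge0 (addr_ge0 (mulr_ge0 c3 (P _ _)) (P _ _)) B_ge0).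
have -> : p + 2 = (p + 1) + 1 by ring.
rewrite -!(@mulr_powRD1 _ (p + 1)); [|lra..].
by field; rewrite !gt_eqF//; lra.
Qed.

Lemma right_coefficients (R : realType) (p lambda A B : R) :
  0 < p -> 0 <= lambda -> lambda <= 1 / 2 -> 0 <= A -> 0 <= B ->
  let N := (1 / 2 * (p + 1 + 2 * lambda) * (1 / 2 - lambda) `^ (p + 1)
             + lambda `^ (p + 2)) * A
           + (1 / 2 * (p + 3 - 2 * lambda) * (1 / 2 - lambda) `^ (p + 1)
             + (p + 2 - lambda) * lambda `^ (p + 1)) * B in
  0 <= N /\
  (lambda * A + (1 - lambda) * B) / (p + 1) *
    (lambda `^ (p + 1) + (1 / 2 - lambda) `^ (p + 1)) +
  (B - A) / (p + 2) * (lambda `^ (p + 2) - (1 / 2 - lambda) `^ (p + 2)) =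
  N / ((p + 1) * (p + 2)).
Proof.
move=> p_gt0 lambda_ge lambda_le A_ge0 B_ge0 /=.
have c1 : 0 <= 1 / 2 * (p + 1 + 2 * lambda) by lra.
have c2 : 0 <= p + 2 - lambda by lra.
have c3 : 0 <= 1 / 2 * (p + 3 - 2 * lambda) by lra.
split.
  have P (x y : R) : 0 <= x `^ y := powR_ge0 x y.
  exact: addr_ge0 (mulr_ge0 (addr_ge0 (mulr_ge0 c1 (P _ _)) (P _ _)) A_ge0)
    (mulr_ge0 (addr_ge0 (mulr_ge0 c3 (P _ _)) (mulr_ge0 c2 (P _ _))) B_ge0).
have -> : p + 2 = (p + 1) + 1 by ring.
rewrite -!(@mulr_powRD1 _ (p + 1)); [|lra..].
by field; rewrite !gt_eqF//; lra.
Qed.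

(** The triangle inequality for the two halves.  All powers are taken of opaque
    variables, which keeps the normalisation of the identities small. *)
Lemma combine_halves (R : realType)
    (L lambda mu fa fb fm J1 J2 e n q S1 N1 S2 N2 : R) :
  0 < L -> 0 < e -> 0 < n -> 0 <= S1 -> 0 <= N1 -> 0 <= S2 -> 0 <= N2 ->
  `|L * (mu - 1 / 2) * fm + L * (1 - mu) * fa - J1|
    <= L ^+ 2 * ((S1 / e) `^ (1 - 1 / q) * (N1 / n) `^ (1 / q)) ->
  `|L * lambda * fb + L * (1 / 2 - lambda) * fm - J2|
    <= L ^+ 2 * ((S2 / e) `^ (1 - 1 / q) * (N2 / n) `^ (1 / q)) ->
  `|(1 - mu) * fa + lambda * fb + (mu - lambda) * fm - 1 / L * (J1 + J2)|
    <= L * e^-1 `^ (1 - 1 / q) * (1 / n) `^ (1 / q)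
       * (S2 `^ (1 - 1 / q) * N2 `^ (1 / q)
          + S1 `^ (1 - 1 / q) * N1 `^ (1 / q)).
Proof.
move=> L_gt0 e_gt0 n_gt0 S1_ge0 N1_ge0 S2_ge0 N2_ge0.
rewrite !powR_bound_split// => H1 H2.
have -> : (1 - mu) * fa + lambda * fb + (mu - lambda) * fm
    - 1 / L * (J1 + J2) =
  L^-1 * ((L * (mu - 1 / 2) * fm + L * (1 - mu) * fa - J1)
          + (L * lambda * fb + L * (1 / 2 - lambda) * fm - J2)).
  by field; lra.
rewrite normrM gtr0_norm ?invr_gt0// mulrC ler_pdivrMr//.
apply: le_trans (ler_normD _ _) _; apply: le_trans (lerD H1 H2) _.
by rewrite le_eqVlt; apply/orP; left; apply/eqP; ring.
Qed.

Theorem theorem3p2 (R : realType) (I : set R) (f : R -> R)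
    (a b lambda mu p q : R) :
  is_interval I ->
  (forall x, (I°) x -> derivable f x 1) ->
  I a -> I b -> a < b ->
  0 <= lambda -> lambda <= 1 / 2 -> 1 / 2 <= mu -> mu <= 1 ->
  (forall x, x \in `[a, b] -> derivable_in I f x) ->
  lebesgue_measure.-integrable `[a, b] (EFin \o derive_in I f) ->
  1 < q ->
  convex_function `[a, b] (fun x : R => `|derive_in I f x| `^ q) ->
  0 < p -> p <= q ->
  `| (1 - mu) * f a + lambda * f b + (mu - lambda) * f ((a + b) / 2)
     - 1 / (b - a) * (\int[lebesgue_measure]_(x in `[a, b]) f x) |
  <= (b - a)
     * ((q - 1) / (2 * q - p - 1)) `^ (1 - 1 / q)
     * (1 / ((p + 1) * (p + 2))) `^ (1 / q)
     * ( ((1 / 2 - lambda) `^ ((2 * q - p - 1) / (q - 1))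
           + lambda `^ ((2 * q - p - 1) / (q - 1))) `^ (1 - 1 / q)
         * ( (1 / 2 * (p + 1 + 2 * lambda) * (1 / 2 - lambda) `^ (p + 1)
               + lambda `^ (p + 2)) * `|derive_in I f a| `^ q
             + (1 / 2 * (p + 3 - 2 * lambda) * (1 / 2 - lambda) `^ (p + 1)
                 + (p + 2 - lambda) * lambda `^ (p + 1))
               * `|derive_in I f b| `^ q ) `^ (1 / q)
       + ((mu - 1 / 2) `^ ((2 * q - p - 1) / (q - 1))
           + (1 - mu) `^ ((2 * q - p - 1) / (q - 1))) `^ (1 - 1 / q)
         * ( (1 / 2 * (p + 1 + 2 * mu) * (mu - 1 / 2) `^ (p + 1)
               + (p + 1 + mu) * (1 - mu) `^ (p + 1)) * `|derive_in I f a| `^ q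
             + (1 / 2 * (p + 3 - 2 * mu) * (mu - 1 / 2) `^ (p + 1)
                 + (1 - mu) `^ (p + 2)) * `|derive_in I f b| `^ q )
           `^ (1 / q) ).
Proof.
move=> iI DI Ia Ib ab l0 l12 mu12 mu1 Dab intdf q_gt1 cdf p_gt0 pq.
have cf : {within `[a, b], continuous f}.
  have sub : `[a, b] `<=` I.
    by move=> x /=; rewrite in_itv/=; exact: (iI a b).
  apply/subspace_continuousP => x xab.
  apply: cvg_trans (derivable_in_continuous (Dab _ xab)); apply: cvg_app.
  exact: within_subset.
have Df : {in `]a, b[, forall x : R, is_derive x 1 f (derive_in I f x)}.
  move=> x xab; have Ix : I° x by apply: (itvoo_sub_interior iI Ia Ib).
  exact: is_derive_derive_in (DI _ Ix).
have r1_ge0 : 0 <= mu - 1 / 2 by lra.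
have l1_ge0 : 0 <= 1 - mu by lra.
have l2_ge0 : 0 <= 1 / 2 - lambda by lra.
have lr1_gt0 : 0 < 1 - mu + (mu - 1 / 2) by lra.
have lr2_gt0 : 0 < 1 / 2 - lambda + lambda by lra.
have r1_mu : mu - 1 / 2 <= mu by lra.
have mu_l1 : mu <= 1 - (1 - mu) by lra.
have lambda_l2 : lambda <= 1 - (1 / 2 - lambda) by lra.
have mid_in : a <= (a + b) / 2 /\ (a + b) / 2 <= b by split; lra.
have e_gt0 : 0 < (2 * q - p - 1) / (q - 1) by rewrite divr_gt0//; lra.
have n_gt0 : 0 < (p + 1) * (p + 2) by rewrite mulr_gt0//; lra.
have L_gt0 : 0 < b - a by rewrite subr_gt0.
(* In units of [L = b - a], the node [b - L * mu] is at distance [1 - mu] from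
   [a] and [mu - 1 / 2] from the midpoint; the node [b - L * lambda] is at
   distance [1 / 2 - lambda] from the midpoint and [lambda] from [b]. *)
have H1 := convex_quadrature_le ab q_gt1 p_gt0 pq cf Df cdf
  l1_ge0 r1_ge0 lr1_gt0 r1_mu mu_l1.
have H2 := convex_quadrature_le ab q_gt1 p_gt0 pq cf Df cdf
  l2_ge0 l0 lr2_gt0 (lexx lambda) lambda_l2.
move: H1 H2; cbv zeta.
have -> : b - (b - a) * lambda - (b - a) * (1 / 2 - lambda) = (a + b) / 2.
  by field.
have -> : b - (b - a) * lambda + (b - a) * lambda = b by ring.
have -> : b - (b - a) * mu - (b - a) * (1 - mu) = a by ring.
have -> : b - (b - a) * mu + (b - a) * (mu - 1 / 2) = (a + b) / 2 by field.
have -> : (q - 1) / (2 * q - p - 1) = ((2 * q - p - 1) / (q - 1))^-1.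
  by rewrite invf_div.
set e := (2 * q - p - 1) / (q - 1) in e_gt0 *.
set A := `|derive_in I f a| `^ q; set B := `|derive_in I f b| `^ q.
have A_ge0 : 0 <= A := powR_ge0 _ _.
have B_ge0 : 0 <= B := powR_ge0 _ _.
have [N1_ge0 ->] := left_coefficients p_gt0 mu12 mu1 A_ge0 B_ge0.
have [N2_ge0 ->] := right_coefficients p_gt0 l0 l12 A_ge0 B_ge0.
have S1_ge0 : 0 <= (mu - 1 / 2) `^ e + (1 - mu) `^ e.
  by rewrite addr_ge0 ?powR_ge0.
have S2_ge0 : 0 <= lambda `^ e + (1 / 2 - lambda) `^ e.
  by rewrite addr_ge0 ?powR_ge0.
rewrite [(1 / 2 - lambda) `^ e + _]addrC => H1 H2.
rewrite (Rintegral_itvD mid_in.1 mid_in.2 cf).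
exact: combine_halves L_gt0 e_gt0 n_gt0 S1_ge0 N1_ge0 S2_ge0 N2_ge0 H1 H2.
Qed.
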